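(* Let $m\le n$ be positive integers and let $A=(a_{ij})$ be an $m\times n$ matrix with nonnegative real entries and maximum entry $\alpha$. Suppose that $\|A\|_1\ge n\alpha$. Then $$\mathcal{E}(A)\le \frac{\|A\|_1}{\sqrt{mn}}+\sqrt{(m-1)\left(\operatorname{tr}(AA^{*})-\frac{\|A\|_1^{2}}{mn}\right)}.$$
   Context: For a complex $m\times n$ matrix $A$, $A^{*}$ denotes its Hermitian adjoint (conjugate transpose). The singular values $\sigma_1(A)\ge\sigma_2(A)\ge\dots$ of $A$ are the square roots of the eigenvalues of $AA^{*}$ (counted with multiplicity). The energy of $A$ is $\mathcal{E}(A)=\sigma_1(A)+\sigma_2(A)+\cdots$, the sum of all singular values of $A$. The norm $\|A\|_1=\sum_{i,j}|a_{ij}|$ is the entrywise $\ell_1$ norm. *)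

(* Defs.v *)
From HB Require Import structures.
From mathcomp Require Import all_boot all_order all_algebra.
From mathcomp Require Import reals complex.

Set Implicit Arguments.
Unset Strict Implicit.
Unset Printing Implicit Defensive.

Import Order.TTheory GRing.Theory Num.Theory.

Local Open Scope ring_scope.
Local Open Scope sesquilinear_scope.

(* The roots of the characteristic polynomial, each repeated according to its
   algebraic multiplicity, in an unspecified order. *)
Definition eigenvalues (C : numClosedFieldType) (n : nat) (B : 'M[C]_n) :
    seq C :=
  sval (closed_field_poly_normal (char_poly B)).

Lemma char_poly_eigenvalues (C : numClosedFieldType) (n : nat) (B : 'M[C]_n) :
  char_poly B = \prod_(z <- eigenvalues B) ('X - z%:P).
Proof.
rewrite /eigenvalues; case: closed_field_poly_normal => r /= {1}->.
by rewrite (monicP (char_poly_monic B)) scale1r.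
Qed.

Lemma size_eigenvalues (C : numClosedFieldType) (n : nat) (B : 'M[C]_n) :
  size (eigenvalues B) = n.
Proof.
have := size_char_poly B.
by rewrite char_poly_eigenvalues size_prod_XsubC => -[].
Qed.

(* The eigenvalues of [A *m A^t*] are real and nonnegative, so [sqrtC] is the
   usual square root on them. *)
Definition singular_values (C : numClosedFieldType) (m n : nat)
    (A : 'M[C]_(m, n)) : seq C :=
  sort >=%R [seq sqrtC z | z <- eigenvalues (A *m A^t*)].

Definition energy (C : numClosedFieldType) (m n : nat) (A : 'M[C]_(m, n)) : C :=
  \sum_(s <- singular_values A) s.

Definition entrywise_l1 (C : numClosedFieldType) (m n : nat)
    (A : 'M[C]_(m, n)) : C :=
  \sum_i \sum_j `|A i j|.

Definition is_max_entry (C : numClosedFieldType) (m n : nat)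
    (A : 'M[C]_(m, n)) (alpha : C) : Prop :=
  (forall i j, A i j <= alpha) /\ (exists i j, A i j = alpha).

(* Main.v *)
Require Import Defs.
From mathcomp Require Import all_boot all_order all_algebra.
From mathcomp Require Import reals complex.
From mathcomp Require Import ring.
(** With [S] the entrywise l1 norm, [T] the trace of [A *m A^t*] and
    [x = S / sqrt (m n)], the argument (in the manner of Koolen and Moulton)
    rests on two facts.

    The largest singular value is at least [x]: the Rayleigh quotient of
    [A *m A^t*] at the all-ones vector is the sum of the squared column sums of
    [A] divided by [m], and by Cauchy-Schwarz over the [n] columns this is at
    least [S ^ 2 / (m n)] ([rayleigh_le_spectral], [l1_le_spectral]).

    If some singular value [s] is at least [x], then Cauchy-Schwarz on the
    other [m - 1] gives energy at most [s + sqrt ((m - 1) (T - s ^ 2))].  As a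
    function of [s] this bound decreases once [s ^ 2 >= T / m], so [s] may be
    replaced by [x] provided that [T <= m x ^ 2] ([sum_le_of_large_entry]).

    The hypothesis on [S] supplies this condition, which reads
    [n T <= S ^ 2]: each entry is at most [alpha], so [T <= alpha S]
    ([trace_gram_le]), whence [n T <= n alpha S <= S ^ 2].

    The singular values are reached through the spectral theorem for the
    Hermitian matrix [A *m A^t*], whose diagonal form lists the same roots of
    the characteristic polynomial ([eigenvalues_spectral]). *)

Set Implicit Arguments.
Unset Strict Implicit.
Unset Printing Implicit Defensive.

Import Order.TTheory GRing.Theory Num.Theory.
Local Open Scope ring_scope.
Local Open Scope sesquilinear_scope.

(** * Inequalities for finite sums *)

(** Cauchy-Schwarz against the constant vector 1, obtained by summing
    [2 a b <= a ^ 2 + b ^ 2] over all pairs of terms. *)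
Lemma sqr_sum_le_card (R : numDomainType) (I : finType) (P : pred I)
    (f : I -> R) (f_real : forall i, f i \is Num.real) :
  (\sum_(i | P i) f i) ^+ 2 <= #|P|%:R * \sum_(i | P i) f i ^+ 2.
Proof.
have: \sum_(i | P i) \sum_(j | P j) f i * f j *+ 2 <=
      \sum_(i | P i) \sum_(j | P j) (f i ^+ 2 + f j ^+ 2).
  by apply: ler_sum => i _; apply: ler_sum => j _;
    apply: real_leif_mean_square_scaled.
have ->: \sum_(i | P i) \sum_(j | P j) f i * f j *+ 2 =
    (\sum_(i | P i) f i) ^+ 2 *+ 2.
  rewrite expr2 mulr_suml -sumrMnl; apply: eq_bigr => i _.
  by rewrite mulr_sumr -sumrMnl.
have ->: \sum_(i | P i) \sum_(j | P j) (f i ^+ 2 + f j ^+ 2) =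
    #|P|%:R * (\sum_(i | P i) f i ^+ 2) *+ 2.
  under eq_bigr do rewrite big_split /= sumr_const.
  by rewrite big_split /= sumrMnl sumr_const mulr_natl mulr2n.
by rewrite lerMn2r.
Qed.

(** The decrease of [fun s => s + sqrt ((m - 1) (T - s ^ 2))] beyond
    [sqrt (T / m)], without calculus.  Let [r] be the sum of the entries other
    than [s i0], and [b] the square root in the conclusion.  Cauchy-Schwarz
    bounds [r ^ 2], which makes [b ^ 2 - r ^ 2] at least
    [(m - 1) (s i0 ^ 2 - x ^ 2)].  Factor both differences of squares: the
    condition [T <= m x ^ 2] gives [b <= (m - 1) x], so the factor [b + r] is
    at most [(m - 1) (s i0 + x)], and cancelling leaves [s i0 - x <= b - r]. *)
Lemma sum_le_of_large_entry (C : numClosedFieldType) (m : nat)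
    (s : 'I_m -> C) (i0 : 'I_m) (x : C) (s_ge0 : forall i, 0 <= s i)
    (x_ge0 : 0 <= x) (le_xs : x <= s i0)
    (sqr_le : \sum_i s i ^+ 2 <= m%:R * x ^+ 2) :
  \sum_i s i <= x + sqrtC ((m%:R - 1) * (\sum_i s i ^+ 2 - x ^+ 2)).
Proof.
set T := \sum_i s i ^+ 2 in sqr_le *.
set b := sqrtC _.
have m1_ge0 : 0 <= m%:R - 1 :> C.
  by rewrite subr_ge0 ler1n (leq_ltn_trans _ (ltn_ord i0)).
have T_eq : T = s i0 ^+ 2 + \sum_(i | i != i0) s i ^+ 2 by rewrite /T (bigD1 i0).
rewrite (bigD1 i0) //=; set r := \sum_(i | i != i0) s i.
have r_ge0 : 0 <= r by apply: sumr_ge0.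
have r_le : r ^+ 2 <= (m%:R - 1) * (T - s i0 ^+ 2).
  have -> : T - s i0 ^+ 2 = \sum_(i | i != i0) s i ^+ 2.
    by rewrite T_eq addrC addKr.
  have -> : m%:R - 1 = #|predC1 i0|%:R :> C.
    by rewrite cardC1 card_ord -subn1 natrB // (leq_ltn_trans _ (ltn_ord i0)).
  by apply: sqr_sum_le_card => i; apply: ger0_real.
have s2x2 : x ^+ 2 <= s i0 ^+ 2 by rewrite lerXn2r ?nnegrE ?s_ge0.
have Tx_ge0 : 0 <= T - x ^+ 2.
  rewrite subr_ge0 (le_trans s2x2) // T_eq lerDl.
  by apply: sumr_ge0 => i _; rewrite exprn_ge0.
have b_ge0 : 0 <= b by rewrite sqrtC_ge0 mulr_ge0.
have b2 : b ^+ 2 = (m%:R - 1) * (T - x ^+ 2) by rewrite sqrtCK.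
have le_rb : r <= b.
  rewrite -(@ler_pXn2r _ 2) ?nnegrE // b2 (le_trans r_le) //.
  by rewrite ler_wpM2l // lerB.
have le_bx : b <= (m%:R - 1) * x.
  rewrite -(@ler_pXn2r _ 2) ?nnegrE ?mulr_ge0 // b2.
  rewrite exprMn [X in _ <= X * _]expr2 -mulrA ler_wpM2l //.
  by rewrite mulrBl mul1r lerB.
have gap : (m%:R - 1) * (s i0 + x) * (s i0 - x) <= (b - r) * (b + r).
  have -> : (b - r) * (b + r) = b ^+ 2 - r ^+ 2 by ring.
  rewrite b2 lerBrDr (le_trans (lerD (lexx _) r_le)) //.
  by rewrite le_eqVlt; apply/orP; left; apply/eqP; ring.
have brx : b + r <= (m%:R - 1) * (s i0 + x).
  rewrite mulrDr addrC lerD // (le_trans le_rb) // (le_trans le_bx) //.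
  by rewrite ler_wpM2l.
have key : (m%:R - 1) * (s i0 + x) * (s i0 - x)
           <= (m%:R - 1) * (s i0 + x) * (b - r).
  by rewrite (le_trans gap) // mulrC ler_wpM2r // subr_ge0.
suff : s i0 - x <= b - r by rewrite lerBlDr addrAC lerBrDr [b + x]addrC.
(* The cancelled factor vanishes only when [m = 1], where [T = s i0 ^ 2], or
   when [s i0 = x = 0]; in both cases [s i0 = x]. *)
have [c0|c_neq0] := eqVneq ((m%:R - 1) * (s i0 + x)) 0; last first.
  have c_gt0 : 0 < (m%:R - 1) * (s i0 + x).
    by rewrite lt_def c_neq0 mulr_ge0 // addr_ge0.
  by rewrite -(ler_pM2l c_gt0).
have -> : s i0 = x.
  apply/eqP; rewrite eq_le le_xs andbT.
  move/eqP: c0; rewrite mulf_eq0 => /orP[|].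
    rewrite subr_eq0 => /eqP m1; rewrite -(@ler_pXn2r _ 2) ?nnegrE //.
    rewrite (le_trans _ (le_trans sqr_le _)) ?m1 ?mul1r // T_eq lerDl.
    by apply: sumr_ge0 => i _; rewrite exprn_ge0.
  by rewrite paddr_eq0 // => /andP[/eqP-> _].
by rewrite subrr subr_ge0.
Qed.

(** * Spectra of normal and Gram matrices *)

Lemma char_poly_conj (F : fieldType) (n : nat) (P D : 'M[F]_n) :
  P \in unitmx -> char_poly (invmx P *m D *m P) = char_poly D.
Proof.
move=> P_unit.
have PK : map_mx polyC (invmx P) *m map_mx polyC P = 1%:M.
  by rewrite -map_mxM mulVmx // map_mx1.
have E : char_poly_mx (invmx P *m D *m P) =
    map_mx polyC (invmx P) *m char_poly_mx D *m map_mx polyC P.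
  rewrite /char_poly_mx mulmxBr mulmxBl -!map_mxM; congr (_ - _).
  by rewrite -mulmxA mul_scalar_mx -scalemxAr PK scalemx1.
by rewrite /char_poly E !det_mulmx mulrAC -det_mulmx PK det1 mul1r.
Qed.

(** Both lists split the characteristic polynomial into linear factors, and
    such a splitting is unique up to order. *)
Lemma eigenvalues_spectral (C : numClosedFieldType) (n : nat) (B : 'M[C]_n) :
  B \is normalmx ->
  perm_eq (eigenvalues B) [seq spectral_diag B 0 i | i <- enum 'I_n].
Proof.
move=> /orthomx_spectralP B_eq; apply: prod_XsubC_eq.
rewrite -char_poly_eigenvalues big_map big_enum /= {1}B_eq.
rewrite char_poly_conj ?spectral_unit // char_poly_trig ?diag_mx_is_trig //.
by apply: eq_bigr => i _; rewrite mxE eqxx mulr1n.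
Qed.

Lemma gram_diag (C : numClosedFieldType) (m n : nat) (A : 'M[C]_(m, n)) i :
  (A *m A^t*) i i = \sum_j `|A i j| ^+ 2.
Proof. by rewrite mxE; apply: eq_bigr => j _; rewrite !mxE normCK. Qed.

Lemma trmxC_mul (C : numClosedFieldType) (m n p : nat)
    (A : 'M[C]_(m, n)) (B : 'M[C]_(n, p)) : (A *m B)^t* = B^t* *m A^t*.
Proof. by rewrite trmx_mul map_mxM. Qed.

Lemma gram_hermitian (C : numClosedFieldType) (m n : nat) (A : 'M[C]_(m, n)) :
  A *m A^t* \is hermsymmx.
Proof.
by apply/is_hermitianmxP; rewrite expr0 scale1r trmxC_mul trmxCK.
Qed.

Lemma spectral_diagE (C : numClosedFieldType) (n : nat) (B : 'M[C]_n) :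
  B \is normalmx ->
  diag_mx (spectral_diag B) = spectralmx B *m B *m (spectralmx B)^t*.
Proof.
move=> /orthomx_spectralP B_eq; rewrite {3}B_eq.
rewrite -invmx_unitary ?spectral_unitarymx //.
by rewrite mulmxA mulmxK ?spectral_unit // mulKVmx ?spectral_unit.
Qed.

(** With [P] the eigenbasis, the diagonal form of [A *m A^t*] is the Gram
    matrix of [P *m A], whose diagonal entries are squared row norms. *)
Lemma gram_spectral_ge0 (C : numClosedFieldType) (m n : nat)
    (A : 'M[C]_(m, n)) i : 0 <= spectral_diag (A *m A^t*) 0 i.
Proof.
have /matrixP/(_ i i) :=
  spectral_diagE (hermitian_normalmx (gram_hermitian A)).
rewrite mxE eqxx mulr1n => ->.
rewrite mulmxA -mulmxA -trmxC_mul gram_diag.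
by apply: sumr_ge0 => j _; rewrite exprn_ge0.
Qed.

(** In the coordinates [v = u *m P^t*] of the eigenbasis the quadratic form is
    [\sum_j d_j |v_j|^2], with the same norm as [u], so the index of the largest
    eigenvalue serves for every [u].  Maximality makes sense although the order
    is partial because the eigenvalues of a Hermitian matrix are real. *)
Lemma rayleigh_le_spectral (C : numClosedFieldType) (n : nat) (B : 'M[C]_n)
    (n_gt0 : (0 < n)%N) (B_herm : B \is hermsymmx) :
  exists i, forall u : 'rV_n,
    (u *m B *m u^t*) 0 0 <= spectral_diag B 0 i * (u *m u^t*) 0 0.
Proof.
set d := spectral_diag B; set P := spectralmx B.
have d_real i : d 0 i \is Num.real.
  by apply/mxOverP/hermitian_spectral_diag_real.
have [i _ i_max] := @real_arg_maxP _ _ (Ordinal n_gt0) predT (d 0) isT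
  (fun i _ => d_real i).
exists i => u.
pose v := u *m P^t*.
have Pu : P \is unitarymx := spectral_unitarymx B.
have -> : u *m u^t* = v *m v^t*.
  by rewrite /v trmxC_mul trmxCK mulmxA mulmxKtV.
have -> : u *m B *m u^t* = v *m diag_mx d *m v^t*.
  rewrite spectral_diagE ?hermitian_normalmx // /v trmxC_mul trmxCK -/P !mulmxA.
  by rewrite !mulmxKtV.
rewrite gram_diag mxE mulr_sumr; apply: ler_sum => j _.
rewrite mul_mx_diag !mxE mulrAC -normCK mulrC ler_wpM2r ?exprn_ge0 //.
exact: i_max.
Qed.

Lemma trace_spectral (C : numClosedFieldType) (n : nat) (B : 'M[C]_n) :
  B \is normalmx -> \tr B = \sum_i spectral_diag B 0 i.
Proof.
move=> /orthomx_spectralP B_eq; rewrite {1}B_eq mxtrace_mulC mulmxA.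
by rewrite mulmxV ?spectral_unit // mul1mx mxtrace_diag.
Qed.

Lemma energy_spectral (C : numClosedFieldType) (m n : nat) (A : 'M[C]_(m, n)) :
  energy A = \sum_i sqrtC (spectral_diag (A *m A^t*) 0 i).
Proof.
rewrite /energy /singular_values (perm_big _ (permEl (perm_sort _ _))) /= big_map.
rewrite (perm_big _ (eigenvalues_spectral _)) /=; last first.
  exact/hermitian_normalmx/gram_hermitian.
by rewrite big_map big_enum.
Qed.

(** * The energy of a nonnegative matrix *)

Lemma entrywise_l1E (C : numClosedFieldType) (m n : nat) (A : 'M[C]_(m, n)) :
  (forall i j, 0 <= A i j) -> entrywise_l1 A = \sum_i \sum_j A i j.
Proof.
by move=> A_ge0; do 2!apply: eq_bigr => ? _; apply: ger0_norm.
Qed.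

(** A singular value is at least the l1 norm over [sqrt (m n)], by the Rayleigh
    bound at the all-ones row vector, whose image under [A] lists the column
    sums. *)
Lemma l1_le_spectral (C : numClosedFieldType) (m n : nat) (A : 'M[C]_(m, n))
    (m_gt0 : (0 < m)%N) (n_gt0 : (0 < n)%N) (A_ge0 : forall i j, 0 <= A i j) :
  exists i, entrywise_l1 A / sqrtC (m * n)%:R
            <= sqrtC (spectral_diag (A *m A^t*) 0 i).
Proof.
have [i i_max] := rayleigh_le_spectral m_gt0 (gram_hermitian A).
exists i.
have mn_gt0 : 0 < (m * n)%:R :> C by rewrite ltr0n muln_gt0 m_gt0.
have S_ge0 : 0 <= entrywise_l1 A by do 2!apply: sumr_ge0 => ? _.
rewrite -(@ler_pXn2r _ 2) ?nnegrE ?divr_ge0 ?sqrtC_ge0 ?gram_spectral_ge0 ?ler0n //.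
rewrite expr_div_n !sqrtCK ler_pdivrMr //.
(* For the all-ones vector [u], the scalar [u *m u^t*] is [m], and
   [u A A^t* u^t*] is the squared norm of the vector of column sums. *)
have := i_max (const_mx 1); set d := spectral_diag _ 0 i.
rewrite gram_diag; under eq_bigr do rewrite mxE normr1 expr1n.
rewrite sumr_const card_ord mulmxA -mulmxA -trmxC_mul gram_diag => sum_le.
rewrite natrM mulrA mulrC (le_trans _ (ler_wpM2l _ sum_le)) //.
have col_sum j : (const_mx 1 *m A) 0 j = \sum_i A i j :> C.
  by rewrite mxE; apply: eq_bigr => k _; rewrite mxE mul1r.
have col_ge0 j : 0 <= \sum_i A i j by apply: sumr_ge0.
under eq_bigr do rewrite col_sum ger0_norm //.
rewrite entrywise_l1E // exchange_big /= -[n in n%:R]card_ord.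
by apply: sqr_sum_le_card => j; apply: ger0_real.
Qed.

Lemma trace_gram_le (C : numClosedFieldType) (m n : nat) (A : 'M[C]_(m, n))
    (alpha : C) (A_ge0 : forall i j, 0 <= A i j)
    (A_le : forall i j, A i j <= alpha) :
  \tr (A *m A^t*) <= alpha * entrywise_l1 A.
Proof.
rewrite mulr_sumr; apply: ler_sum => i _; rewrite gram_diag mulr_sumr.
by apply: ler_sum => j _; rewrite expr2 ler_wpM2r // ger0_norm.
Qed.

(* In the order of R[i], [0 <= z] means that z is real and nonnegative. *)
Theorem theorem1 (R : realType) (m n : nat) (m_gt0 : (0 < m)%N)
    (le_mn : (m <= n)%N) (A : 'M[R[i]]_(m, n)) (alpha : R[i])
    (A_ge0 : forall i j, 0 <= A i j)
    (alpha_max : is_max_entry A alpha)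
    (l1_ge : n%:R * alpha <= entrywise_l1 A) :
  energy A <=
    entrywise_l1 A / sqrtC (m * n)%:R
    + sqrtC ((m%:R - 1)
             * (\tr (A *m A^t*) - entrywise_l1 A ^+ 2 / (m * n)%:R)).
Proof.
have n_gt0 : (0 < n)%N by apply: leq_trans le_mn.
have mn_gt0 : 0 < (m * n)%:R :> R[i] by rewrite ltr0n muln_gt0 m_gt0.
have S_ge0 : 0 <= entrywise_l1 A by do 2!apply: sumr_ge0 => ? _.
have [i0 le_x] := l1_le_spectral m_gt0 n_gt0 A_ge0.
have sum_sqr : \sum_i sqrtC (spectral_diag (A *m A^t*) 0 i) ^+ 2
             = \tr (A *m A^t*).
  rewrite trace_spectral ?hermitian_normalmx ?gram_hermitian //.
  by apply: eq_bigr => i _; rewrite sqrtCK.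
rewrite energy_spectral -sum_sqr.
have -> : entrywise_l1 A ^+ 2 / (m * n)%:R
        = (entrywise_l1 A / sqrtC (m * n)%:R) ^+ 2.
  by rewrite expr_div_n sqrtCK.
apply: (sum_le_of_large_entry _ _ le_x).
- by move=> i; rewrite sqrtC_ge0 gram_spectral_ge0.
- by rewrite divr_ge0 ?sqrtC_ge0 ?ler0n.
rewrite sum_sqr expr_div_n sqrtCK natrM mulrA -mulf_div divff ?mul1r; last first.
  by rewrite pnatr_eq0 -lt0n.
rewrite ler_pdivlMr ?ltr0n //.
have [A_le _] := alpha_max.
rewrite (le_trans (ler_wpM2r _ (trace_gram_le A_ge0 A_le))) //.
by rewrite mulrC mulrA expr2 ler_wpM2r.
Qed.
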